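(* Let $\mathcal{A}^{[m,n]}$ and $\mathcal{B}^{[m,n]}$ be multiary graded polyadic algebras, and let $\Phi:\mathcal{A}^{[m,n]}\to\mathcal{B}^{[m,n]}$ be a multiary graded homomorphism. Then the quotient algebra $\mathcal{A}^{[m,n]}/\ker_\theta\Phi$ is isomorphic to the graded image $\operatorname{im}\Phi$, which is a subalgebra of $\mathcal{B}^{[m,n]}$: $$\mathcal{A}^{[m,n]}/\ker_\theta\Phi\;\cong\;\operatorname{im}\Phi.$$ The isomorphism is one preserving the polyadic algebra operations and the multiary grading.
   Context: **Polyadic algebra.** $\mathcal{A}^{[m,n]}=\langle A\mid\nu_a^{[m]},\mu_a^{[n]}\rangle$ is an algebra over an ordinary (binary) field $\Bbbk$ with a totally associative $m$-ary addition $\nu_a^{[m]}$ and a totally associative $n$-ary multiplication $\mu_a^{[n]}$ that is distributive over the addition; similarly for $\mathcal{B}^{[m,n]}$ with $\nu_b^{[m]},\mu_b^{[n]}$. No zero or unit is required. **Multiary grading.** An $n'$-ary group $\mathsf{G}^{[n']}$ is a set with a totally associative $n'$-ary operation $\mu_g^{[n']}$ such that every element $\mathsf{g}$ has a unique querelement $\bar{\mathsf{g}}$ with $\mu_g^{[n']}[\mathsf{g},\ldots,\mathsf{g},\bar{\mathsf{g}}]=\mathsf{g}$ ($n'-1$ copies of $\mathsf{g}$); grading groups are assumed commutative. $\mathcal{A}^{[m,n]}$ is graded by $\mathsf{G}^{[n']}$ if it is a direct sum of $\Bbbk$-vector spaces $\mathcal{A}^{[m,n]}=\bigoplus_{\mathsf{g}\in\mathsf{G}^{[n']}}\mathcal{A}(\mathsf{g})$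 with $\mu_a^{[n]}[\mathcal{A}(\mathsf{g}_1),\ldots,\mathcal{A}(\mathsf{g}_n)]\subseteq\mathcal{A}(\mu_g^{[n']}[\mathsf{g}_1,\ldots,\mathsf{g}_{n'}])$. Similarly $\mathcal{B}^{[m,n]}=\bigoplus_{\mathsf{h}\in\mathsf{H}^{[n']}}\mathcal{B}(\mathsf{h})$ is graded by an $n'$-ary group $\mathsf{H}^{[n']}$. Standing assumption: the multiplications $\mu_a^{[n]}$ and $\mu_g^{[n']}$ are nonderived, i.e. they are not compositions of binary operations only. **Graded homomorphism.** A pair of maps $\Phi:\mathcal{A}^{[m,n]}\to\mathcal{B}^{[m,n]}$ and $\Psi:\mathsf{G}^{[n']}\to\mathsf{H}^{[n']}$ such that $\Phi(\nu_a^{[m]}[\mathbf{a}_1,\ldots,\mathbf{a}_m])=\nu_b^{[m]}[\Phi(\mathbf{a}_1),\ldots,\Phi(\mathbf{a}_m)]$, $\Phi(\mu_a^{[n]}[\mathbf{a}_1,\ldots,\mathbf{a}_n])=\mu_b^{[n]}[\Phi(\mathbf{a}_1),\ldots,\Phi(\mathbf{a}_n)]$, $\Psi$ is a homomorphism of $n'$-ary groups, and $\Phi(\mathcal{A}(\mathsf{g}))\subseteq\mathcal{B}(\Psi(\mathsf{g}))$ for all $\mathsf{g}\in\mathsf{G}^{[n']}$. When $\Psi=\mathrm{id}$ this reads $\Phi(\mathcal{A}(\mathsf{g}))\subseteq\mathcal{B}(\mathsf{g})$. **Image.** $\operatorname{im}\Phi=\{\Phi(\mathbf{a})\mid\mathbf{a}\in\mathcal{A}^{[m,n]}\}\subseteq\mathcal{B}^{[m,n]}$,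 with homogeneous components $\Phi(\mathcal{A}(\mathsf{g}))$, $\mathsf{g}\in\mathsf{G}^{[n']}$. **Congruence kernel and quotient.** $\theta=\ker_\theta\Phi=\{(\mathbf{a}_1,\mathbf{a}_2)\in\mathcal{A}^{[m,n]}\times\mathcal{A}^{[m,n]}\mid\Phi(\mathbf{a}_1)=\Phi(\mathbf{a}_2)\}$. The quotient $\mathcal{A}^{[m,n]}/\ker_\theta\Phi$ is the set of equivalence classes $\lfloor\mathbf{a}\rfloor_\theta$ with operations on representatives, $\bar\nu^{[m]}[\lfloor\mathbf{a}_1\rfloor_\theta,\ldots,\lfloor\mathbf{a}_m\rfloor_\theta]=\lfloor\nu_a^{[m]}[\mathbf{a}_1,\ldots,\mathbf{a}_m]\rfloor_\theta$ and $\bar\mu^{[n]}[\lfloor\mathbf{a}_1\rfloor_\theta,\ldots,\lfloor\mathbf{a}_n\rfloor_\theta]=\lfloor\mu_a^{[n]}[\mathbf{a}_1,\ldots,\mathbf{a}_n]\rfloor_\theta$. Its homogeneous component $\bar{\mathcal{A}}(\mathsf{g})$ consists of the classes of elements of $\mathcal{A}(\mathsf{g})$. **Isomorphism.** A bijection preserving $\nu$ and $\mu$; preserving the grading means that it maps $\bar{\mathcal{A}}(\mathsf{g})$ onto $\Phi(\mathcal{A}(\mathsf{g}))$ for every $\mathsf{g}\in\mathsf{G}^{[n']}$. *)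

(* Defs.v *)
From mathcomp Require Import all_boot all_order perm all_algebra.
From mathcomp Require Import generic_quotient.
From mathcomp Require Import finmap.
From mathcomp Require Import classical_sets functions.

Set Implicit Arguments.
Unset Strict Implicit.
Unset Printing Implicit Defensive.

Import GRing.Theory.
Local Open Scope classical_set_scope.
Local Open Scope quotient_scope.
Local Open Scope ring_scope.

Definition nary (n : nat) (T : Type) : Type := {ffun 'I_n -> T} -> T.

(* op[a_0, ..., a_{i-1}, op[a_i, ..., a_{i+n-1}], a_{i+n}, ..., a_{2n-2}];
   only the first 2n-1 terms of the sequence a are used. *)
Definition nested (n : nat) (T : Type) (op : nary n T) (a : nat -> T)
    (i : 'I_n) : T :=
  op [ffun j : 'I_n =>
        if (j < i)%N then a j
        else if j == i then op [ffun k : 'I_n => a (i + k)%N]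
        else a (j + n.-1)%N].

Definition totally_associative (n : nat) (T : Type) (op : nary n T) : Prop :=
  forall (a : nat -> T) (i j : 'I_n), nested op a i = nested op a j.

Definition nary_commutative (n : nat) (T : Type) (op : nary n T) : Prop :=
  forall (a : {ffun 'I_n -> T}) (s : {perm 'I_n}), op [ffun i => a (s i)] = op a.

(* A derived operation is the iteration of one associative binary operation.
   Allowing several distinct binary operations would be pointless: on an
   infinite set every operation is then such a composition (Sierpinski). *)
Definition derived (n : nat) (T : Type) (op : nary n T) : Prop :=
  exists2 op2 : T -> T -> T, associative op2 &
    forall a : nat -> T,
      op [ffun i : 'I_n => a i] = foldl op2 (a 0%N) [seq a i | i <- iota 1 n.-1].

Definition replace_at (n : nat) (T : Type) (a : {ffun 'I_n -> T}) (i : 'I_n)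
    (x : T) : {ffun 'I_n -> T} :=
  [ffun j => if j == i then x else a j].

Definition distributive_over (m n : nat) (T : Type)
    (nu : nary m T) (mu : nary n T) : Prop :=
  forall (a : {ffun 'I_n -> T}) (i : 'I_n) (b : {ffun 'I_m -> T}),
    mu (replace_at a i (nu b)) = nu [ffun j => mu (replace_at a i (b j))].

Definition preserves (n : nat) (T U : Type) (f : T -> U)
    (opT : nary n T) (opU : nary n U) : Prop :=
  forall a : {ffun 'I_n -> T}, f (opT a) = opU [ffun i => f (a i)].

Definition closed_under (n : nat) (T : Type) (op : nary n T) (S : set T) : Prop :=
  forall a : {ffun 'I_n -> T}, (forall i, S (a i)) -> S (op a).

(* The binary vector-space addition carried by the lmodType is the one in which
   direct sums are taken; the m-ary addition padd need not be its iteration and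
   is tied to the vector space only through the scalars. *)
Structure polyadicAlg (K : fieldType) (m n : nat) := PolyadicAlg {
  pa_sort :> lmodType K;
  padd : nary m pa_sort;
  pmul : nary n pa_sort;
  paddA : totally_associative padd;
  pmulA : totally_associative pmul;
  pmulD : distributive_over padd pmul;
  paddZ : forall (k : K) (a : {ffun 'I_m -> pa_sort}),
    padd [ffun i => k *: a i] = k *: padd a;
  pmulZ : forall (k : K) (a : {ffun 'I_n -> pa_sort}) (i : 'I_n),
    pmul (replace_at a i (k *: a i)) = k *: pmul a }.

Structure multiaryGroup (n' : nat) := MultiaryGroup {
  mg_sort :> choiceType;
  gmul : nary n' mg_sort;
  gmulA : totally_associative gmul;
  querelement : forall g : mg_sort, exists! q : mg_sort,
    gmul [ffun i : 'I_n' => if i == n'.-1 :> nat then q else g] = g }.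

Definition subspace (K : fieldType) (V : lmodType K) (W : set V) : Prop :=
  W 0 /\ forall (k : K) (x y : V), W x -> W y -> W (k *: x + y).

(* Every vector is the sum of a unique finitely supported family of vectors
   c g taken in V_ g. *)
Definition direct_sum (K : fieldType) (V : lmodType K) (I : choiceType)
    (V_ : I -> set V) : Prop :=
  forall x : V, exists! c : {fsfun I -> V with 0},
    (forall g, V_ g (c g)) /\ x = \sum_(g <- finsupp c) c g.

Structure gradedAlg (K : fieldType) (m n n' : nat) (G : multiaryGroup n') :=
  GradedAlg {
    ga_alg :> polyadicAlg K m n;
    hcomp : G -> set ga_alg;
    hcomp_subspace : forall g, subspace (hcomp g);
    hcomp_padd : forall g, closed_under (padd (p := ga_alg)) (hcomp g);
    hcomp_sum : direct_sum hcomp;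
    (* The degrees g 0, g 1, ... are shared by both sides, so that the i-th
       factor of the n-ary product has the degree which is the i-th factor of
       the n'-ary one. *)
    hcomp_pmul : forall (g : nat -> G) (a : {ffun 'I_n -> ga_alg}),
      (forall i : 'I_n, hcomp (g i) (a i)) ->
      hcomp (gmul [ffun i : 'I_n' => g i]) (pmul a) }.

Section Homomorphism.
Variables (K : fieldType) (m n n' : nat) (G H : multiaryGroup n').
Variables (A : gradedAlg K m n G) (B : gradedAlg K m n H).

Definition graded_hom (Phi : A -> B) (Psi : G -> H) : Prop :=
  [/\ preserves Phi (padd (p := A)) (padd (p := B)),
      preserves Phi (pmul (p := A)) (pmul (p := B)),
      preserves Psi (gmul (m := G)) (gmul (m := H))
    & forall g : G, Phi @` hcomp g `<=` hcomp (Psi g)].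

Definition subalgebra (S : set B) : Prop :=
  [/\ S !=set0, closed_under (padd (p := B)) S & closed_under (pmul (p := B)) S].

Variable Phi : A -> B.

Definition ker_theta : rel A := fun a1 a2 => Phi a1 == Phi a2.

Lemma ker_theta_refl : reflexive ker_theta.
Proof. by move=> a; rewrite /ker_theta. Qed.

Lemma ker_theta_sym : symmetric ker_theta.
Proof. by move=> a b; rewrite /ker_theta eq_sym. Qed.

Lemma ker_theta_trans : transitive ker_theta.
Proof. by move=> b a c /eqP ab /eqP bc; rewrite /ker_theta ab bc. Qed.

Canonical ker_theta_equiv :=
  EquivRel ker_theta ker_theta_refl ker_theta_sym ker_theta_trans.

Definition quot_alg : Type := {eq_quot ker_theta}.

Definition qclass (a : A) : quot_alg := \pi_{eq_quot ker_theta} a.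

(* Computed on the canonical representatives; independence of the choice of
   representatives is [well_defined]. *)
Definition quot_op (k : nat) (op : nary k A) : nary k quot_alg :=
  fun c => qclass (op [ffun i => repr (c i : {eq_quot ker_theta})]).

Definition well_defined (k : nat) (op : nary k A) : Prop :=
  forall a : {ffun 'I_k -> A}, quot_op op [ffun i => qclass (a i)] = qclass (op a).

Definition quot_hcomp (g : G) : set quot_alg := qclass @` hcomp g.

Definition graded_iso_onto_image (f : quot_alg -> B) : Prop :=
  [/\ set_bij [set: quot_alg] (range Phi) f,
      preserves f (quot_op (padd (p := A))) (padd (p := B)),
      preserves f (quot_op (pmul (p := A))) (pmul (p := B))
    & forall g : G, f @` quot_hcomp g = Phi @` hcomp g].

End Homomorphism.

(* Main.v *)
Require Import Defs.
From mathcomp Require Import all_boot all_order all_algebra.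
From mathcomp Require Import generic_quotient.
From mathcomp Require Import boolp classical_sets functions.

(** This is the first isomorphism theorem for sets with operations of arbitrary
arity.  Two elements of [A] have the same class exactly when they have the same
image under [Phi] ([qclass_eqP]), so [Phi] factors through the quotient as
[induced_map], which is injective because the congruence is the whole fibre
relation of [Phi], and whose range is that of [Phi].

Everything about the operations then follows from preservation alone, whatever
the arity: the image of a composite depends only on the images of its arguments,
so operations descend to classes ([preserves_well_defined]), are carried by the
induced map ([induced_map_preserves]) and cannot leave the range
([preserves_closed_range]).  The grading is respected because the degree [g]
component of the quotient consists, by definition, of the classes of degree [g]
elements, and the induced map sends the class of [a] to [Phi a]. *)

Set Implicit Arguments.
Unset Strict Implicit.
Unset Printing Implicit Defensive.

Local Open Scope classical_set_scope.
Local Open Scope quotient_scope.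

(** The preimages of the arguments have to be chosen simultaneously, which is
where choice enters. *)
Lemma preserves_closed_range (k : nat) (T U : Type) (f : T -> U)
    (opT : nary k T) (opU : nary k U) :
  preserves f opT opU -> closed_under opU (range f).
Proof.
move=> fop b fb.
have /choice[a fa] : forall i, exists x, f x = b i.
  by move=> i; have [x _ <-] := fb i; exists x.
exists (opT [ffun i => a i]) => //.
by rewrite fop; congr opU; apply/ffunP => i; rewrite !ffunE.
Qed.

Section FirstIsomorphism.
Variables (K : fieldType) (m n n' : nat) (G H : multiaryGroup n').
Variables (A : gradedAlg K m n G) (B : gradedAlg K m n H) (Phi : A -> B).

Lemma qclass_eqP (a b : A) : qclass Phi a = qclass Phi b <-> Phi a = Phi b.
Proof.
split=> [/eqmodP/eqP //|ab].
by apply/eqmodP; rewrite /= /ker_theta ab.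
Qed.

Definition induced_map (c : quot_alg Phi) : B :=
  Phi (repr (c : {eq_quot (ker_theta Phi)})).

Lemma qclass_repr (c : quot_alg Phi) :
  qclass Phi (repr (c : {eq_quot (ker_theta Phi)})) = c.
Proof. exact: reprK. Qed.

Lemma induced_map_qclass (a : A) : induced_map (qclass Phi a) = Phi a.
Proof. by apply/qclass_eqP; rewrite qclass_repr. Qed.

Lemma induced_map_bij : set_bij [set: quot_alg Phi] (range Phi) induced_map.
Proof.
split=> [c _|c d _ _ cd|_ [a _ <-]].
- by exists (repr (c : {eq_quot (ker_theta Phi)})).
- by rewrite -(qclass_repr c) -(qclass_repr d); apply/qclass_eqP.
- by exists (qclass Phi a); rewrite ?induced_map_qclass.
Qed.

Lemma induced_map_hcomp (g : G) :
  induced_map @` quot_hcomp g = Phi @` hcomp g.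
Proof.
rewrite /quot_hcomp (image_comp (qclass Phi) induced_map); congr (_ @` _).
by apply/funext => a; apply: induced_map_qclass.
Qed.

Lemma preserves_well_defined (k : nat) (opA : nary k A) (opB : nary k B) :
  preserves Phi opA opB -> well_defined Phi opA.
Proof.
move=> Phiop a; apply/qclass_eqP; rewrite !Phiop; congr opB.
by apply/ffunP => i; rewrite !ffunE; apply: induced_map_qclass.
Qed.

Lemma induced_map_preserves (k : nat) (opA : nary k A) (opB : nary k B) :
  preserves Phi opA opB -> preserves induced_map (quot_op opA) opB.
Proof.
move=> Phiop c; rewrite induced_map_qclass Phiop; congr opB.
by apply/ffunP => i; rewrite !ffunE.
Qed.

End FirstIsomorphism.

Theorem theorem4p13 (K : fieldType) (m n n' : nat)
    (hm : (2 <= m)%N) (hn : (2 <= n)%N) (hn' : (2 <= n')%N)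
    (G H : multiaryGroup n')
    (hG : nary_commutative (gmul (m := G)))
    (hH : nary_commutative (gmul (m := H)))
    (A : gradedAlg K m n G) (B : gradedAlg K m n H)
    (hmuA : ~ derived (pmul (p := A))) (hmuG : ~ derived (gmul (m := G)))
    (Phi : A -> B) (Psi : G -> H) (hPhi : graded_hom Phi Psi) :
  [/\ well_defined Phi (padd (p := A)),
      well_defined Phi (pmul (p := A)),
      subalgebra (range Phi)
    & exists f : quot_alg Phi -> B, graded_iso_onto_image f].
Proof.
have [Phi_add Phi_mul _ _] := hPhi; split.
- exact: preserves_well_defined Phi_add.
- exact: preserves_well_defined Phi_mul.
- split; first by exists (Phi 0%R), 0%R.
  + exact: preserves_closed_range Phi_add.
  + exact: preserves_closed_range Phi_mul.
- exists (@induced_map _ _ _ _ _ _ _ _ Phi); split.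
  + exact: induced_map_bij.
  + exact: induced_map_preserves Phi_add.
  + exact: induced_map_preserves Phi_mul.
  + exact: induced_map_hcomp.
Qed.
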